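(* Let $V=(V_1,\dots,V_k)$ be a doubly twisted tuple of isometries on a Hilbert space $\mathcal H$ with corresponding twists $\{U_{ij}\}_{i\neq j}\subset\mathcal B(\mathcal H)$. Then $V$ admits a doubly twisted unitary extension.
   Context: A $k$-tuple of isometries $(V_1,\dots,V_k)$ on $\mathcal H$ is doubly twisted with respect to a commuting family of unitaries $\{U_{ij}\}_{i<j}$ on $\mathcal H$, with $U_{ji}:=U_{ij}^*$, if for all $i\ne j$ and all $\ell$ in $\{1,\dots,k\}$: $V_iV_j=U_{ij}V_jV_i$, $V_i^*V_j=U_{ij}^*V_jV_i^*$, $V_\ell U_{ij}=U_{ij}V_\ell$. A doubly twisted unitary extension of $V$ is a Hilbert space $\mathcal K$ containing $\mathcal H$ (isometrically) together with unitaries $\widehat V_1,\dots,\widehat V_k$ on $\mathcal K$ and unitaries $\{\widehat U_{ij}\}_{i\neq j}$ on $\mathcal K$ such that $\widehat V_i|_{\mathcal H}=V_i$, $\widehat U_{ij}|_{\mathcal H}=U_{ij}$, and $(\widehat V_1,\dots,\widehat V_k)$ is doubly twisted with respect to $\{\widehat U_{ij}\}$. *)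

(* Defs.v *)
From HB Require Import structures.
From mathcomp Require Import all_boot all_order all_algebra.
From mathcomp Require Import sesquilinear.
From mathcomp Require Import complex.
From mathcomp Require Import boolp classical_sets reals topology normedtype.

Set Implicit Arguments.
Unset Strict Implicit.
Unset Printing Implicit Defensive.

Import Order.TTheory GRing.Theory Num.Theory.

Local Open Scope classical_set_scope.
Local Open Scope ring_scope.

(* Complex Hilbert spaces; the inner product is linear in its first argument
   and conjugate-linear in the second. *)
HB.mixin Record CompleteNormedModule_isHilbert (R : realType) H
    & CompleteNormedModule R[i] H := {
  inner : {dot H for (@Num.conj R[i])} ;
  innerxx : forall x : H, inner x x = `|x| ^+ 2
}.

#[short(type="hilbertType")]
HB.structure Definition Hilbert (R : realType) :=
  {H of CompleteNormedModule R[i] H & CompleteNormedModule_isHilbert R H}.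

Section Operators.
Context {R : realType}.
Implicit Types H K : hilbertType R.

(* The vector [adjoint A y] is the z with <A x, y> = <x, z> for all x. It is
   unique when it exists (adjoint_eq), and by the Riesz representation theorem
   it exists for every bounded A; the default value 0 is used otherwise. *)
Definition adjoint H K (A : H -> K) (y : K) : H :=
  xget 0 [set z | forall x, inner (A x) y = inner x z].

Lemma adjoint_eq H K (A : H -> K) (y : K) (z : H) :
  (forall x, inner (A x) y = inner x z) -> adjoint A y = z.
Proof.
move=> Az; apply: xget_unique => //= w Aw; apply/eqP; rewrite -subr_eq0.
by rewrite -(dnorm_eq0 inner) linearBr /= -Aw -Az subrr.
Qed.

Definition isometric H K (A : {linear H -> K}) := forall x, `|A x| = `|x|.

Definition unitary H (A : {linear H -> H}) :=
  cancel A (adjoint A) /\ cancel (adjoint A) A.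

Definition commuting H (A B : H -> H) := A \o B =1 B \o A.

(* The diagonal entries U i i are unconstrained and never used. *)
Record doubly_twisted H k (V : 'I_k -> {linear H -> H})
    (U : 'I_k -> 'I_k -> {linear H -> H}) : Prop := {
  twisted_isometric : forall i, isometric (V i) ;
  twist_unitary : forall i j : 'I_k, (i < j)%N -> unitary (U i j) ;
  twist_commuting : forall i j p q : 'I_k, (i < j)%N -> (p < q)%N ->
    commuting (U i j) (U p q) ;
  twist_adjoint : forall i j : 'I_k, (i < j)%N -> U j i =1 adjoint (U i j) ;
  twisted_mul : forall i j : 'I_k, i != j ->
    V i \o V j =1 U i j \o V j \o V i ;
  twisted_adjoint_mul : forall i j : 'I_k, i != j ->
    adjoint (V i) \o V j =1 adjoint (U i j) \o V j \o adjoint (V i) ;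
  twisted_twist : forall i j l : 'I_k, i != j -> commuting (V l) (U i j)
}.

(* K contains H through the linear isometry J. *)
Record doubly_twisted_unitary_extension H k (V : 'I_k -> {linear H -> H})
    (U : 'I_k -> 'I_k -> {linear H -> H}) K (J : {linear H -> K})
    (hatV : 'I_k -> {linear K -> K})
    (hatU : 'I_k -> 'I_k -> {linear K -> K}) : Prop := {
  ext_isometric : isometric J ;
  ext_unitary : forall i, unitary (hatV i) ;
  ext_twist_unitary : forall i j : 'I_k, i != j -> unitary (hatU i j) ;
  ext_restrict : forall i x, hatV i (J x) = J (V i x) ;
  ext_twist_restrict : forall i j : 'I_k, i != j ->
    forall x, hatU i j (J x) = J (U i j x) ;
  ext_doubly_twisted : doubly_twisted hatV hatU
}.

End Operators.

(* Main.v *)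
(* Let [T = V_1 ... V_k]. Modulo the twists, [V_i] commutes with [T]:
   [V_i T = W_i T V_i], where [W_i] is a product of twists, and [T = V_i S_i]
   with [S_i] isometric. So it is enough to make the single isometry [T]
   invertible, that is, to pass to the inductive limit of [H -T-> H -T-> ...]:
   writing [T^-n x] for the copy of [x] in its [n]-th term, [V_i] extends by
   [T^-n x |-> T^-n (W_i^-n V_i x)], with inverse
   [T^-n x |-> T^-(n+1) (W_i^(n+1) S_i x)].
   No quotient or completion is needed if the limit is replaced by its dual
   [K], the space of bounded sequences [h] in [H] with [T^* h_(n+1) = h_n]:
   the maps above act on [K] by adjunction, hence the inverse of the unitary
   extending [V_i] is [h |-> ((W_i^-n V_i)^* h_n)_n], and [H] embeds by
   [x |-> (T^n x)_n]. *)

Require Import Defs.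
From HB Require Import structures.
From mathcomp Require Import all_boot all_order all_algebra.
From mathcomp Require Import sesquilinear complex.
From mathcomp Require Import boolp classical_sets reals topology normedtype.
From mathcomp Require Import functions ring lra.

Set Implicit Arguments.
Unset Strict Implicit.
Unset Printing Implicit Defensive.

Import Order.TTheory GRing.Theory Num.Theory.
Import numFieldNormedType.Exports.

Local Open Scope classical_set_scope.
Local Open Scope ring_scope.

(* Stated over an abstract [C] because on [R[i]] the [rmorph] lemmas pick the
   instance of [conjc] instead of [Num.conj]. *)
Section Conjugation.
Context {C : numClosedFieldType}.
Implicit Types x y : C.

Lemma conjCD x y : (x + y)^* = x^* + y^*. Proof. exact: rmorphD. Qed.
Lemma conjCN x : (- x)^* = - x^*. Proof. exact: rmorphN. Qed.
Lemma conjCM x y : (x * y)^* = x^* * y^*. Proof. exact: rmorphM. Qed.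

End Conjugation.

(** * Hilbert space identities and adjoints of isometries *)

Section HilbertTheory.
Context {R : realType}.
Implicit Types H K : hilbertType R.

Lemma norm_ReE H (x : H) : `|x| = (complex.Re `|x|)%:C%C.
Proof. by rewrite RRe_real// normr_real. Qed.

Lemma innerC H (x y : H) : inner x y = (inner y x)^*%R.
Proof. by rewrite (hermC inner) expr0 mul1r. Qed.

Lemma normD2 H (x y : H) :
  `|x + y| ^+ 2 = `|x| ^+ 2 + `|y| ^+ 2 + (inner x y + inner y x).
Proof. by rewrite -!innerxx hnormD /= expr0 mul1r -innerC. Qed.

Lemma normB2 H (x y : H) :
  `|x - y| ^+ 2 = `|x| ^+ 2 + `|y| ^+ 2 - (inner x y + inner y x).
Proof. by rewrite -!innerxx hnormB /= expr0 mul1r -innerC. Qed.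

Lemma parallelogram H (x y : H) :
  `|x + y| ^+ 2 + `|x - y| ^+ 2 = 2 * (`|x| ^+ 2 + `|y| ^+ 2).
Proof. by rewrite normD2 normB2 addrACA subrr addr0 mulr2n mulrDl !mul1r. Qed.

Lemma polarization H (x y : H) :
  inner x y = 4^-1 * (`|x + y| ^+ 2 - `|x - y| ^+ 2
                      + 'i * (`|x + 'i *: y| ^+ 2 - `|x - 'i *: y| ^+ 2)).
Proof.
rewrite !normB2 !normD2 linearZl_LR linearZr_LR /= conjCi.
have addB (a b c : R[i]) : a + b + c - (a + b - c) = 2 * c by ring.
rewrite !addB.
have -> : 'i * (2 * (- 'i * inner x y + 'i * inner y x))
   = - 'i ^+ 2 * 2 * (inner x y - inner y x) by ring.
by rewrite sqrCi; field.
Qed.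

Lemma isometric_inner H K (A : {linear H -> K}) : isometric A ->
  forall x y, inner (A x) (A y) = inner x y.
Proof.
by move=> Aiso x y; rewrite !polarization -linearZ -!linearD -!linearB !Aiso.
Qed.

Lemma isometric_inj H K (A : {linear H -> K}) : isometric A -> injective A.
Proof.
move=> Aiso x y xy; apply/eqP; rewrite -subr_eq0 -normr_eq0 -Aiso linearB xy.
by rewrite subrr normr0.
Qed.

(** Minimality makes [A z - y] orthogonal to the range of [A]: if [c] were nonzero, moving [z]
    slightly along [x] would bring [A z] closer to [y]. *)
Lemma closest_point_adjoint H K (A : {linear H -> K}) (y : K) (z : H) :
  isometric A -> (forall x, `|A z - y| <= `|A x - y|) ->
  forall x, inner (A x) y = inner x z.
Proof.
move=> Aiso zmin x.
suff: inner (A x) (A z - y) = 0.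
  by rewrite linearBr /= isometric_inner// => /eqP; rewrite subr_eq0 => /eqP.
set c := inner (A x) (A z - y).
(* With the step [t = - s c^*], the squared distance changes by [s^2 |c|^2 |x|^2 - 2 s |c|^2], at
   most [- s |c|^2] since [s |x|^2 <= 1]. The [+ 1] covers [x = 0]. *)
pose s := (`|x| ^+ 2 + 1)^-1.
have s0 : 0 < s by rewrite invr_gt0 ltr_wpDl// exprn_ge0.
have sx : s * `|x| ^+ 2 <= 1.
  by rewrite mulrC ler_pdivrMr ?mul1r ?lerDl// ltr_wpDl// exprn_ge0.
pose t := - s * c^*.
have st : `|t| = s * `|c| by rewrite /t normrM normrN norm_conjC (gtr0_norm s0).
have tJ : t^* = - s * c.
  by rewrite /t conjCM conjCN conjCK (CrealP (gtr0_real s0)).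
have : `|A z - y| ^+ 2 <= `|A (z + t *: x) - y| ^+ 2.
  by rewrite lerXn2r// ?nnegrE.
rewrite linearD addrAC (normD2 (A z - y)) -addrA lerDl.
rewrite Aiso normrZ st exprMn linearZ linearZl_LR linearZr_LR /= -/c.
rewrite [inner _ (A x)]innerC -/c tJ /t.
have -> : - s * c * c^* + - s * c^* * c = - (2 * s * `|c| ^+ 2).
  by rewrite normCK; ring.
rewrite subr_ge0 exprMn => h.
have sc : 0 <= s * `|c| ^+ 2 by rewrite mulr_ge0 ?exprn_ge0// ltW.
have {}h : s * `|c| ^+ 2 * 2 <= s * `|c| ^+ 2 * 1.
  apply: le_trans (ler_wpM2l sc sx).
  have -> : s * `|c| ^+ 2 * 2 = 2 * s * `|c| ^+ 2 by ring.
  by apply: le_trans h _; rewrite le_eqVlt; apply/orP; left; apply/eqP; ring.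
apply/eqP; rewrite -normr_eq0; apply: contraTT h => c0.
have scp : 0 < s * `|c| ^+ 2.
  by rewrite mulr_gt0// exprn_gt0// lt_def c0 normr_ge0.
by rewrite ler_pM2l// (ler_nat _ 2 1).
Qed.

(* The nearest point to [y] in the range of [A] exists by completeness, the
   parallelogram law making the almost nearest points a Cauchy filter. *)
Lemma isometric_adjointP H K (A : {linear H -> K}) : isometric A ->
  forall x y, inner (A x) y = inner x (adjoint A y).
Proof.
move=> Aiso x y.
suff [z zmin] : exists z, forall x, `|A z - y| <= `|A x - y|.
  have Az := closest_point_adjoint Aiso zmin.
  by rewrite Az (adjoint_eq Az).
(* Norms take values in [R[i]]; real parts are taken so that [inf] makes sense. *)
pose r x := complex.Re `|A x - y|.
have rE u : `|A u - y| = (r u)%:C%C by rewrite norm_ReE.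
have r_ge0 u : 0 <= r u by rewrite -ler0c -rE.
pose m := inf (range r).
have r_inf : has_inf (range r).
  by split; [exists (r 0), 0 | exists 0 => _ [u _ <-]].
have m_le u : m <= r u by apply: ge_inf; [case: r_inf | exists u].
have m_ge0 : 0 <= m by apply: lb_le_inf; [case: r_inf | move=> _ [u _ <-]].
pose near_min e := [set u | r u < m + e].
pose F := filter_from [set e : R | 0 < e] near_min.
have near_min0 e : 0 < e -> near_min e !=set0.
  by move=> /inf_adherent -/(_ _ r_inf)[_ [u _ <-] um]; exists u.
have FF : ProperFilter F.
  apply: filter_from_proper => //; apply: filter_from_filter.
    by exists 1; rewrite /= ltr01.
  move=> e1 e2 e1_gt0 e2_gt0; exists (Order.min e1 e2).
    by rewrite /= lt_min e1_gt0.
  by move=> u; rewrite /near_min /= -ltrBlDl lt_min !ltrBlDl => /andP[].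
(* At the midpoint [w], the parallelogram law gives [|u - v|^2 = 2 (r u^2 + r v^2) - 4 r w^2], which
   is at most [4 (m + e)^2 - 4 m^2]. *)
have near_min_dist e u v : 0 < e -> near_min e u -> near_min e v ->
    (complex.Re `|u - v|) ^+ 2 <= 4 * e * (2 * m + e).
  move=> e_gt0 ue ve; pose w := 2^-1 *: (u + v).
  have ruv : (complex.Re `|u - v|) ^+ 2 + 4 * r w ^+ 2
           = 2 * (r u ^+ 2 + r v ^+ 2).
    have := parallelogram (A u - y) (A v - y).
    have -> : A u - y - (A v - y) = A (u - v).
      by rewrite (linearB A) opprB addrA subrK.
    have -> : A u - y + (A v - y) = 2 *: (A w - y).
      rewrite /w linearZ /= scalerBr scalerA divff ?pnatr_eq0// scale1r linearD.
      by rewrite addrACA -opprD scaler_nat mulr2n.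
    rewrite normrZ Aiso !rE [`|u - v|]norm_ReE normr_nat.
    rewrite -(rmorph_nat (real_complex R)) -!rmorphXn -!rmorphM -!rmorphXn.
    rewrite -!rmorphD -!rmorphM.
    by move=> /complexI <- /=; ring.
  have mw : m ^+ 2 <= r w ^+ 2 by rewrite ler_sqr ?nnegrE.
  have ru : r u ^+ 2 <= (m + e) ^+ 2.
    by rewrite ler_sqr ?nnegrE ?(ltW ue)// addr_ge0// ltW.
  have rv : r v ^+ 2 <= (m + e) ^+ 2.
    by rewrite ler_sqr ?nnegrE ?(ltW ve)// addr_ge0// ltW.
  nra.
have Fc : cauchy F.
  apply/cauchy_ballP => d d_gt0.
  pose d' := complex.Re d.
  have dE : d = d'%:C%C by rewrite RRe_real// gtr0_real.
  have d'_gt0 : 0 < d' by rewrite -ltcR -dE.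
  (* As [e <= 1], the bound [4 e (2 m + e)] is at most [4 e (2 m + 1)], hence at most [d'^2 / 2]. *)
  pose e := Order.min 1 (d' ^+ 2 / (8 * (2 * m + 1))).
  have e_gt0 : 0 < e.
    by rewrite lt_min ltr01 divr_gt0 ?exprn_gt0 ?mulr_gt0 ?ltr_wpDl ?mulr_ge0.
  exists (near_min e, near_min e); first by split; exists e.
  move=> [u v] [/= ue ve]; rewrite -ball_normE /= dE norm_ReE ltcR.
  have uv_ge0 : 0 <= complex.Re `|u - v| by rewrite -ler0c -norm_ReE.
  rewrite -ltr_sqr ?nnegrE ?(ltW d'_gt0)//.
  apply: le_lt_trans (near_min_dist _ _ _ e_gt0 ue ve) _.
  have e1 : e <= 1 by rewrite ge_min lexx.
  have : e * (8 * (2 * m + 1)) <= d' ^+ 2.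
    by rewrite -ler_pdivlMr ?mulr_gt0 ?ltr_wpDl ?mulr_ge0// ge_min lexx orbT.
  have : 0 < d' ^+ 2 by rewrite exprn_gt0.
  nra.
have /cvg_ex[z Fz] : cvg F by exact: cauchy_cvg.
exists z => u; rewrite !rE lecR; apply: le_trans (m_le u).
apply/ler_addgt0Pr => e e_gt0.
have [v [vz vm]] : (ball z (e / 2)%:C%C `&` near_min (e / 2)) !=set0.
  apply: (@filter_ex _ F); apply: filterI.
    by apply: Fz; apply: nbhsx_ballx; rewrite ltcR divr_gt0.
  by exists (e / 2); rewrite //= divr_gt0.
rewrite -lecR -rE.
have -> : A z - y = A (z - v) + (A v - y) by rewrite (linearB A) addrA subrK.
apply: le_trans (ler_normD _ _) _.
move: vz; rewrite -ball_normE /= => vz.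
rewrite Aiso rE [m + e](_ : _ = e / 2 + (m + e / 2)); last by field.
by rewrite rmorphD; apply: lerD; [exact: ltW | rewrite lecR; exact: ltW].
Qed.

End HilbertTheory.

(** * Limits of norms and inner products *)

(* Scalar limits are stated in [R[i]^o] because [R[i]] itself carries no
   canonical normed module structure. *)
Section InnerProductLimits.
Context {R : realType}.
Implicit Types H : hilbertType R.

Lemma inner_eq H (x y : H) : (forall z, inner z x = inner z y) -> x = y.
Proof.
move=> xy; apply/eqP; rewrite -subr_eq0 -(dnorm_eq0 inner) linearBr /=.
by rewrite xy subrr.
Qed.

(** Expanding [|A y - x|^2] with [<A y, x> = |y|^2] leaves [|x|^2 - |y|^2]. *)
Lemma norm_le_of_adjoint H (A : H -> H) (x y : H) :
  (forall z, `|A z| = `|z|) -> (forall z, inner (A z) x = inner z y) ->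
  `|y| <= `|x|.
Proof.
move=> Aiso Axy; rewrite -ler_sqr ?nnegrE// -subr_ge0.
have -> : `|x| ^+ 2 - `|y| ^+ 2 = `|A y - x| ^+ 2.
  rewrite normB2 Aiso Axy innerxx [inner x _]innerC Axy innerxx.
  by rewrite (CrealP _) ?realX ?normr_real//; ring.
by rewrite exprn_ge0.
Qed.

Lemma cvg_scalar_unique I (F : set_system I) {FF : ProperFilter F}
    (f : I -> R[i]^o) (a b : R[i]^o) :
  f @ F --> a -> f @ F --> b -> a = b :> R[i].
Proof. exact: (cvg_unique (@norm_hausdorff _ _)). Qed.

Lemma cvg_conjC I (F : set_system I) {FF : Filter F}
    (f : I -> R[i]^o) (a : R[i]^o) :
  f @ F --> a -> (f i)^* @[i --> F] --> (a^* : R[i]^o).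
Proof.
move=> fa; apply/cvgrPdist_lt => e e_gt0.
have /cvgrPdist_lt fa' := fa; have := fa' e e_gt0; apply: filterS => i.
by rewrite -conjCN -conjCD norm_conjC.
Qed.

(** Only the four norms have to converge, not [f] and [g]: the terms of a backward orbit in general
    have no limit in [H]. *)
Lemma cvg_polarization I (F : set_system I) {FF : Filter F} H (f g : I -> H)
    (a b c d : R[i]^o) :
  `|f i + g i| @[i --> F] --> a -> `|f i - g i| @[i --> F] --> b ->
  `|f i + 'i *: g i| @[i --> F] --> c -> `|f i - 'i *: g i| @[i --> F] --> d ->
  inner (f i) (g i) @[i --> F] -->
    (4^-1 * (a ^+ 2 - b ^+ 2 + 'i * (c ^+ 2 - d ^+ 2)) : R[i]^o).
Proof.
move=> fa fb fc fd; under eq_fun do rewrite polarization !expr2.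
rewrite !expr2.
exact: (cvgM (cvg_cst (4^-1 : R[i]^o))
  (cvgD (cvgB (cvgM fa fa) (cvgM fb fb))
        (cvgM (cvg_cst ('i : R[i]^o)) (cvgB (cvgM fc fc) (cvgM fd fd))))).
Qed.

Lemma cvg_inner I (F : set_system I) {FF : Filter F} H (f g : I -> H) a b :
  f @ F --> a -> g @ F --> b ->
  inner (f i) (g i) @[i --> F] --> (inner a b : R[i]^o).
Proof.
move=> fa gb; have igb : 'i *: g i @[i --> F] --> 'i *: b.
  by apply: cvgZ => //; exact: cvg_cst.
by rewrite (polarization a); apply: cvg_polarization; apply: cvg_norm;
  first [exact: cvgD | exact: cvgB].
Qed.

End InnerProductLimits.

(** * The Hilbert space of bounded backward orbits *)

Section BackwardOrbits.
Context {R : realType} {H : hilbertType R} (T : {linear H -> H}).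

(** The relation [T^* h_(n+1) = h_n] is tested against vectors: this avoids the default value of
    [adjoint] and passes directly to linear combinations and limits. *)
Definition backward_orbit : {pred nat -> H} := [pred h : nat -> H |
  `[< (forall n y, inner (T y) (h n.+1) = inner y (h n)) /\
      exists M, forall n, `|h n| <= M >]].

Lemma backward_orbit_submod : GRing.submod_closed backward_orbit.
Proof.
split=> [|a h g].
  apply/asboolP; split=> [n y|]; first by rewrite !linear0r.
  by exists 0 => n; rewrite normr0.
move=> /asboolP[hT [M hM]] /asboolP[gT [N gN]].
apply/asboolP; split=> [n y|].
  by rewrite !linearPr /= hT gT.
exists (`|a| * M + N) => n.
apply: le_trans (ler_normD _ _) _.
by rewrite lerD// normrZ ler_wpM2l.
Qed.

HB.instance Definition _ :=
  GRing.isSubmodClosed.Build _ _ backward_orbit backward_orbit_submod.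

(* The dual of the inductive limit of [H -T-> H -T-> H ...], each functional on
   the [n]-th copy of [H] being represented by a vector [h n]. *)
Record orbit_space (Tiso : isometric T) :=
  OrbitSpace { orbit :> nat -> H; _ : orbit \in backward_orbit }.

Context (Tiso : isometric T).
Local Notation K := (orbit_space Tiso).

HB.instance Definition _ := [isSub for @orbit Tiso].
HB.instance Definition _ := [Choice of K by <:].
HB.instance Definition _ := [SubChoice_isSubLmodule of K by <:].

Implicit Types h g : K.

Lemma orbitP h n y : inner (T y) (h n.+1) = inner y (h n).
Proof. by case: h => h /= /asboolP[]. Qed.

Lemma orbit_eq h g : (forall n, h n = g n) -> h = g.
Proof. by move=> hg; apply/val_inj/funext. Qed.

Lemma orbitD h g n : (h + g) n = h n + g n. Proof. by []. Qed.
Lemma orbitZ a h n : (a *: h) n = a *: h n. Proof. by []. Qed.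

Definition orbit_norm h : R[i] :=
  (sup (range (fun n => complex.Re `|h n|)))%:C%C.

Let orbit_has_sup h : has_sup (range (fun n => complex.Re `|h n|)).
Proof.
split; first by exists (complex.Re `|h 0|), 0%N.
case: h => h /= /asboolP[_ [M hM]]; exists (complex.Re M) => _ [n _ <-].
by move: (hM n); rewrite lecE => /andP[].
Qed.

Lemma le_orbit_norm h n : `|h n| <= orbit_norm h.
Proof.
by rewrite norm_ReE lecR; apply: ub_le_sup; [case: (orbit_has_sup h) | exists n].
Qed.

Lemma orbit_norm_le h M : (forall n, `|h n| <= M) -> orbit_norm h <= M.
Proof.
move=> hM; have /RRe_real <- : M \is Num.real.
  by rewrite ger0_real// (le_trans _ (hM 0)).
rewrite lecR; apply: ge_sup => [|_ [n _ <-]]; first by case: (orbit_has_sup h).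
by move: (hM n); rewrite lecE => /andP[].
Qed.

(** Each term is the image of the next under the adjoint of the isometry [T], a contraction. Hence
    the supremum defining [orbit_norm] is a limit, through which identities pass from [H] to [K]. *)
Let orbit_norm_mono h : {homo (fun n => `|h n|) : m n / (m <= n)%N >-> m <= n}.
Proof.
apply: homo_leq => // [? ? ?|n]; first exact: le_trans.
by apply: (norm_le_of_adjoint Tiso) => y; exact: orbitP.
Qed.

Lemma cvg_orbit_norm h : `|h n| @[n --> \oo] --> (orbit_norm h : R[i]^o).
Proof.
apply/cvgrPdist_lt => e e_gt0.
have eE : e = (complex.Re e)%:C%C by rewrite RRe_real// gtr0_real.
have e'_gt0 : 0 < complex.Re e by rewrite -ltcR -eE.
have [_ [N _ <-] hN] := sup_adherent e'_gt0 (orbit_has_sup h).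
exists N => // n /= Nn; rewrite ger0_norm ?subr_ge0 ?le_orbit_norm//.
rewrite ltrBlDl -ltrBlDr; apply: (@lt_le_trans _ _ `|h N|).
  by rewrite eE -rmorphB [ltRHS]norm_ReE ltcR.
exact: orbit_norm_mono.
Qed.

Let orbit_normD h g : orbit_norm (h + g) <= orbit_norm h + orbit_norm g.
Proof.
apply: orbit_norm_le => n; apply: le_trans (ler_normD _ _) _.
by apply: lerD; exact: le_orbit_norm.
Qed.

Let orbit_normZ a h : orbit_norm (a *: h) = `|a| * orbit_norm h.
Proof.
apply: (cvg_scalar_unique (@cvg_orbit_norm (a *: h))).
under eq_fun do rewrite orbitZ normrZ.
by apply: cvgM (@cvg_orbit_norm h); exact: cvg_cst.
Qed.

Let orbit_norm0_eq0 h : orbit_norm h = 0 -> h = 0.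
Proof.
move=> h0; apply: orbit_eq => n; apply/eqP; rewrite -normr_eq0.
by rewrite eq_le normr_ge0 andbT -h0 le_orbit_norm.
Qed.

HB.instance Definition _ := Lmodule_isNormed.Build R[i] K
  orbit_normD orbit_normZ orbit_norm0_eq0.

Lemma le_norm_orbit h n : `|h n| <= `|h|. Proof. exact: le_orbit_norm. Qed.

Lemma norm_orbit_le h M : (forall n, `|h n| <= M) -> `|h| <= M.
Proof. exact: orbit_norm_le. Qed.

Lemma cvg_norm_orbit h : `|h n| @[n --> \oo] --> (`|h| : R[i]^o).
Proof. exact: cvg_orbit_norm. Qed.

(** The limit is taken term by term; it is again a backward orbit by continuity of the inner
    product. *)
Let orbit_complete (F : set_system K) : ProperFilter F -> cauchy F -> cvg F.
Proof.
move=> FF /cauchyP Fc.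
pose ev n (h : K) : H := h n.
have cvgn n : cvg (ev n @ F).
  apply: cauchy_cvg; apply: cauchy_exP => e /Fc[h Fh]; exists (h n : H).
  suff : F [set g : K | ball (h n : H) e (g n)] by [].
  apply: filterS Fh => g; rewrite -!ball_normE /=; apply: le_lt_trans.
  exact: (le_norm_orbit (h - g) n).
pose l n : H := lim (ev n @ F).
have cvgl n : ev n @ F --> l n by exact: cvgn.
(* The auxiliary [g] depends on [n] but the bound does not, so termwise convergence becomes
   convergence in the supremum norm. *)
have near_l e h n : 0 < e -> F (ball h e) -> `|h n - l n| <= e + e.
  move=> e_gt0 Fh; have /cvgrPdist_lt/(_ _ e_gt0) := cvgl n.
  move=> /(filterI Fh)/filter_ex[g []]; rewrite -ball_normE /= => hg gl.
  rewrite -(subrK (g n) (h n)) -addrA; apply: le_trans (ler_normD _ _) _.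
  rewrite lerD//; last by rewrite distrC ltW.
  exact: le_trans (le_norm_orbit (h - g) n) (ltW hg).
have lP : l \in backward_orbit.
  apply/asboolP; split=> [n y|].
    apply: (@cvg_scalar_unique _ _ F _ (fun h => inner (T y) (h n.+1))).
      exact: cvg_inner (cvg_cst (T y)) (cvgl n.+1).
    under eq_fun do rewrite orbitP.
    exact: cvg_inner (cvg_cst y) (cvgl n).
  have [h Fh] := Fc 1 ltr01.
  exists (1 + 1 + `|h|) => n; rewrite -(subrK (h n) (l n)).
  apply: le_trans (ler_normD _ _) _.
  by rewrite lerD ?le_norm_orbit// distrC near_l.
apply/cvg_ex; exists (OrbitSpace Tiso lP : K).
apply/cvgrPdist_lt => e e_gt0.
have e3 : 0 < e / 3 by rewrite divr_gt0.
have [h Fh] := Fc _ e3; apply: filterS (Fh) => g; rewrite -ball_normE /= => hg.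
set k : K := OrbitSpace _ _.
rewrite -(subrK h k) -addrA; apply: le_lt_trans (ler_normD _ _) _.
rewrite [e](_ : _ = e / 3 + e / 3 + e / 3); last by field.
apply: ler_ltD => //; apply: norm_orbit_le => n; rewrite distrC.
exact: near_l.
Qed.

HB.instance Definition _ := Uniform_isComplete.Build K orbit_complete.

(** Polarization of the norm of [K]. It equals the limit of [inner (h n) (g n)], from which
    sesquilinearity and symmetry are inherited. *)
Definition orbit_inner h g : R[i] :=
  4^-1 * (`|h + g| ^+ 2 - `|h - g| ^+ 2
          + 'i * (`|h + 'i *: g| ^+ 2 - `|h - 'i *: g| ^+ 2)).

Lemma cvg_orbit_inner h g :
  inner (h n) (g n) @[n --> \oo] --> (orbit_inner h g : R[i]^o).
Proof.
by apply: cvg_polarization;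
  [ exact: (@cvg_norm_orbit (h + g)) | exact: (@cvg_norm_orbit (h - g))
  | exact: (@cvg_norm_orbit (h + 'i *: g))
  | exact: (@cvg_norm_orbit (h - 'i *: g))].
Qed.

Let orbit_innerC h g : orbit_inner h g = (-1) ^+ false * (orbit_inner g h)^*.
Proof.
rewrite expr0 mul1r; apply: (cvg_scalar_unique (@cvg_orbit_inner h g)).
under eq_fun do rewrite innerC.
exact: (cvg_conjC (@cvg_orbit_inner g h)).
Qed.

Let orbit_innerPl g : linear_for *%R (fun h => orbit_inner h g).
Proof.
move=> a h k; apply: (cvg_scalar_unique (@cvg_orbit_inner _ g)).
under eq_fun do rewrite orbitD orbitZ linearPl.
apply: cvgD (@cvg_orbit_inner k g).
by apply: cvgM (@cvg_orbit_inner h g); exact: cvg_cst.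
Qed.

Let orbit_innerPr h : linear_for (Num.conj \; *%R) (orbit_inner h).
Proof.
move=> a g k; apply: (cvg_scalar_unique (@cvg_orbit_inner h _)).
under eq_fun do rewrite orbitD orbitZ linearPr.
apply: cvgD (@cvg_orbit_inner h k).
by apply: cvgM (@cvg_orbit_inner h g); exact: cvg_cst.
Qed.

Let orbit_innerxx h : orbit_inner h h = `|h| ^+ 2.
Proof.
apply: (cvg_scalar_unique (@cvg_orbit_inner h h)).
under eq_fun do rewrite innerxx expr2.
by rewrite expr2; apply: cvgM; exact: cvg_norm_orbit.
Qed.

Let orbit_inner_gt0 h : h != 0 -> 0 < orbit_inner h h.
Proof. by move=> h0; rewrite orbit_innerxx exprn_gt0// normr_gt0. Qed.

HB.instance Definition _ := bilinear_isBilinear.Build R[i] K K R[i] _ _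
  orbit_inner (orbit_innerPl, orbit_innerPr).
HB.instance Definition _ := isHermitianSesquilinear.Build R[i] K false
  Num.conj orbit_inner orbit_innerC.
HB.instance Definition _ := isDotProduct.Build R[i] K orbit_inner
  orbit_inner_gt0.
HB.instance Definition _ := CompleteNormedModule_isHilbert.Build R K
  orbit_innerxx.

End BackwardOrbits.

(** * Unitaries and iterates *)

(** From [|x| = |G (F x)| <= |F x| <= |x|] the map [F] is isometric, and then
    [<F x, y> = <F x, F (G y)> = <x, G y>]. *)
Lemma contraction_inverse_unitary (R : realType) (H : hilbertType R)
    (F G : {linear H -> H}) :
  (forall x, `|F x| <= `|x|) -> (forall x, `|G x| <= `|x|) ->
  cancel F G -> cancel G F -> [/\ isometric F, adjoint F =1 G & unitary F].
Proof.
move=> Fle Gle FK GK.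
have Fiso : isometric F.
  by move=> x; apply: le_anti; rewrite Fle /= -{1}(FK x) Gle.
have FG : adjoint F =1 G.
  by move=> y; apply: adjoint_eq => x; rewrite -{1}(GK y) isometric_inner.
by split=> //; split=> x; rewrite FG.
Qed.

(** If [adjoint A y] is the default value 0, then [y = A 0 = 0] by cancellation and both sides
    vanish. *)
Lemma unitary_adjointP (R : realType) (H : hilbertType R) (A : {linear H -> H}) :
  unitary A -> forall x y, inner (A x) y = inner x (adjoint A y).
Proof.
move=> [_ AK] x y; have := AK y; rewrite /adjoint.
case: xgetP => [z _ Az _ //|_ <-]; by rewrite linear0 !linear0r.
Qed.

Section IterateLinear.
Context {R : realType} {H : hilbertType R}.
Implicit Types W A : {linear H -> H}.

Fixpoint lpow W n : {linear H -> H} :=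
  if n is n'.+1 then W \o lpow W n' else idfun.

Lemma lpowE W n x : lpow W n x = iter n W x.
Proof. by elim: n => //= n ->. Qed.

Lemma isometric_lpow W n : isometric W -> isometric (lpow W n).
Proof. by move=> Wiso; elim: n => //= n IHn x; rewrite Wiso IHn. Qed.

End IterateLinear.

Lemma commuting_iter (R : realType) (H : hilbertType R) (A W : H -> H) n :
  commuting A W -> commuting A (iter n W).
Proof.
move=> AW; elim: n => //= n IHn x /=.
by rewrite -[iter n W (A x)]IHn; exact: AW.
Qed.

(** * Operators induced on the orbit space *)

Section OrbitOperators.
Context {R : realType} {H : hilbertType R} (T : {linear H -> H}).
Context (Tiso : isometric T).
Local Notation K := (orbit_space Tiso).

Lemma orbit_inner_eq (h g : K) :
  (forall n y, inner y (h n) = inner y (g n)) -> h = g.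
Proof. by move=> hg; apply: orbit_eq => n; apply: inner_eq => y. Qed.

(** [F] is dual to the map [T^-n x |-> T^-(n+a) (B_n x)] of the inductive limit, well defined
    because [B_(n+1) T = T B_n]. *)
Lemma orbit_operator (a : nat) (B : nat -> {linear H -> H}) :
  (forall n, isometric (B n)) -> (forall n x, B n.+1 (T x) = T (B n x)) ->
  exists F : {linear K -> K},
    (forall h, `|F h| <= `|h|) /\
    forall (h : K) n y, inner y (F h n) = inner (B n y) (h (n + a)%N).
Proof.
move=> Biso BT.
pose f (h : K) n := adjoint (B n) (h (n + a)%N).
have fE h n y : inner y (f h n) = inner (B n y) (h (n + a)%N).
  by rewrite -isometric_adjointP.
have fle h n : `|f h n| <= `|h|.
  apply: le_trans (le_norm_orbit h (n + a)).
  by apply: (norm_le_of_adjoint (Biso n)) => y; rewrite fE.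
have fP h : f h \in backward_orbit T.
  apply/asboolP; split=> [n y|]; last by exists `|h|.
  by rewrite !fE BT addSn orbitP.
pose F h : K := OrbitSpace Tiso (fP h).
have Flin : linear F.
  move=> c h g; apply: orbit_inner_eq => n y.
  rewrite [LHS]fE (orbitD (c *: h)) orbitZ [LHS]linearPr.
  rewrite (orbitD (c *: F h)) orbitZ [RHS]linearPr /=.
  by congr (_ * _ + _); exact/esym/fE.
pose L := GRing.isLinear.Build _ _ _ _ F Flin.
pose FL : {linear K -> K} := HB.pack F L.
exists FL; split=> [h|]; last exact: fE.
by apply: norm_orbit_le => n; exact: fle.
Qed.

Lemma orbit_embedding : exists J : {linear H -> K},
  isometric J /\ forall x n, J x n = iter n T x.
Proof.
have iterT n x : `|iter n T x| = `|x| by elim: n => //= n IHn; rewrite Tiso.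
have JP x : (fun n => lpow T n x) \in backward_orbit T.
  apply/asboolP; split=> [n y|]; first by rewrite /= isometric_inner.
  by exists `|x| => n; rewrite lpowE iterT.
pose J x : K := OrbitSpace Tiso (JP x).
have Jlin : linear J.
  by move=> c x y; apply: orbit_eq => n; rewrite orbitD orbitZ /= linearP.
pose L := GRing.isLinear.Build _ _ _ _ J Jlin.
pose JL : {linear H -> K} := HB.pack J L.
exists JL; split=> [x|x n]; last exact: lpowE.
apply: le_anti; rewrite norm_orbit_le /=; last by move=> n; rewrite lpowE iterT.
exact: (le_norm_orbit (J x) 0).
Qed.

Lemma orbit_unitary (A A' : {linear H -> H}) :
  isometric A -> isometric A' -> cancel A A' -> cancel A' A ->
  commuting T A -> commuting T A' ->
  exists F G : {linear K -> K},
    [/\ forall h, `|F h| <= `|h|, forall h, `|G h| <= `|h|,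
        cancel F G, cancel G F &
        forall (h : K) n y, inner y (F h n) = inner (A' y) (h n)].
Proof.
move=> Aiso A'iso AK A'K TA TA'.
have [F [Fle FE]] := @orbit_operator 0 (fun=> A') (fun=> A'iso)
  (fun _ x => esym (TA' x)).
have [G [Gle GE]] := @orbit_operator 0 (fun=> A) (fun=> Aiso)
  (fun _ x => esym (TA x)).
exists F, G; split=> // [h|h|h n y]; last by rewrite FE addn0.
- by apply: orbit_inner_eq => n y; rewrite GE FE !addn0 AK.
- by apply: orbit_inner_eq => n y; rewrite FE GE !addn0 A'K.
Qed.

(** [F] will be the unitary extending [A], and [G] its inverse. Only [G] is given by a formula, so
    later relations are checked on inverses. *)
Lemma orbit_isometry (A W W' S : {linear H -> H}) :
  isometric A -> isometric S -> isometric W -> isometric W' ->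
  cancel W W' -> cancel W' W -> commuting A W ->
  commuting T W -> commuting T W' ->
  (forall x, A (T x) = W (T (A x))) -> (forall x, T x = A (S x)) ->
  exists F G : {linear K -> K},
    [/\ forall h, `|F h| <= `|h|, forall h, `|G h| <= `|h|,
        cancel F G, cancel G F &
        forall (h : K) n y, inner y (G h n) = inner (lpow W' n (A y)) (h n)].
Proof.
move=> Aiso Siso Wiso W'iso WK W'K AW TW TW' AT TAS.
have Ainj := isometric_inj Aiso.
have itK n x : iter n W (iter n W' x) = x.
  by elim: n x => //= n IHn x; rewrite -iterS iterSr W'K IHn.
have itK' n x : iter n W' (iter n W x) = x.
  by elim: n x => //= n IHn x; rewrite -iterS iterSr WK IHn.
have AWn n x : A (iter n W x) = iter n W (A x) := commuting_iter n AW x.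
have TWn n x : T (iter n W x) = iter n W (T x) := commuting_iter n TW x.
have TWn' n x : T (iter n W' x) = iter n W' (T x) := commuting_iter n TW' x.
(* Both sides become [W (T (T x))] under the injective [A]. *)
have WST x : W (S (T x)) = T (S x).
  by apply: Ainj; rewrite (AWn 1) -TAS AT -TAS.
(* Since [T^-n x = T^-(n+1) (A (S x))] and [A] acts on the copy of index [n+1] as [W^-(n+1) A], its
   inverse has shift 1 and exponent [n+1]. *)
have [n||F [Fle FE]] := @orbit_operator 1 (fun n => lpow W n.+1 \o S).
- by move=> x; rewrite /= Wiso isometric_lpow// Siso.
- by move=> n x; rewrite /= !lpowE -!iterS iterSr WST TWn.
have [n||G [Gle GE]] := @orbit_operator 0 (fun n => lpow W' n \o A).
- by move=> x; rewrite /= isometric_lpow// Aiso.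
- by move=> n x; rewrite /= !lpowE -iterS iterSr AT WK TWn'.
exists F, G; split=> // [h|h|h n y]; last by rewrite GE addn0.
(* Testing [h n] against [y] is testing [h n.+1] against [T y]. What remains is
   [W^(n+1) S W^-n A = T], checked after applying [A]. *)
- apply: orbit_inner_eq => n y; rewrite GE FE addn0 addn1 -[RHS]orbitP.
  congr (inner _ _); apply: Ainj.
  by rewrite /= !lpowE -iterS AWn -TAS iterS TWn' itK -AT.
- apply: orbit_inner_eq => n y; rewrite FE GE addn0 addn1 -[RHS]orbitP.
  by rewrite /= !lpowE -!iterS AWn itK' TAS.
Qed.

(** Moving [A] past each [T] costs one factor [W']. This relates the embedded orbits [(T^n x)_n] to
    the formula for [G]. *)
Lemma iter_twist (A W W' : {linear H -> H}) n x :
  cancel W W' -> commuting T W' -> (forall x, A (T x) = W (T (A x))) ->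
  iter n T (A x) = lpow W' n (A (iter n T x)).
Proof.
move=> WK TW' AT; rewrite lpowE; elim: n => //= n ->.
have TWn' := commuting_iter n TW'.
by rewrite -iterS iterSr AT WK; exact: TWn'.
Qed.

End OrbitOperators.

(** * Commutation of the twists and the product of the tuple *)

Section TwistedTuples.
Context {R : realType} {H : hilbertType R} {k : nat}.
Context {V : 'I_k -> {linear H -> H}} {U : 'I_k -> 'I_k -> {linear H -> H}}.
Context (VU : doubly_twisted V U).

Lemma twistK (i j : 'I_k) : i != j -> cancel (U i j) (U j i).
Proof.
rewrite -val_eqE neq_ltn => /orP[] ij x.
  by rewrite (twist_adjoint VU ij) (twist_unitary VU ij).1.
by rewrite (twist_adjoint VU ij) (twist_unitary VU ij).2.
Qed.

Lemma isometric_twist (i j : 'I_k) : i != j -> isometric (U i j).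
Proof.
have lt_iso (p q : 'I_k) : (p < q)%N -> isometric (U p q).
  move=> pq x; apply/eqP; rewrite -(@eqrXn2 _ 2)//; apply/eqP.
  rewrite -!innerxx (unitary_adjointP (twist_unitary VU pq)).
  by rewrite (twist_unitary VU pq).1.
move=> ij x; move: (ij); rewrite -val_eqE neq_ltn => /orP[|] lt_ij.
  exact: lt_iso.
by rewrite -[LHS](lt_iso _ _ lt_ij) twistK.
Qed.

(** Commutation is given for increasing index pairs; a reversed pair yields the inverse operator,
    which is cancelled. *)
Lemma twists_commute (i j p q : 'I_k) :
  i != j -> p != q -> commuting (U i j) (U p q).
Proof.
have half (i0 j0 p0 q0 : 'I_k) : (i0 < j0)%N -> p0 != q0 ->
    commuting (U i0 j0) (U p0 q0).
  move=> ij pq x; move: (pq); rewrite -val_eqE neq_ltn => /orP[|] lt_pq.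
    exact: (twist_commuting VU).
  have qp : q0 != p0 by rewrite eq_sym.
  apply: (can_inj (twistK qp)) => /=.
  by rewrite -[LHS](twist_commuting VU ij lt_pq) /= !twistK.
move=> ij pq x; move: (ij); rewrite -val_eqE neq_ltn => /orP[|] lt_ij.
  exact: half.
have ji : j != i by rewrite eq_sym.
apply: (can_inj (twistK ji)) => /=.
by rewrite twistK// [RHS](half _ _ _ _ lt_ij pq) /= twistK.
Qed.

(** Stands for being a product of twists without naming the factors: such a map commutes with the
    twists and with every [V l]. *)
Definition twist_bicommutant (A : H -> H) := forall B : H -> H,
  (forall i j, i != j -> commuting B (U i j)) -> commuting B A.

Lemma twist_bicommutant_twist (i j : 'I_k) :
  i != j -> twist_bicommutant (U i j).
Proof. by move=> ij B; exact. Qed.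

Lemma twist_bicommutant_comp (A B : H -> H) :
  twist_bicommutant A -> twist_bicommutant B -> twist_bicommutant (A \o B).
Proof.
move=> AU BU C CU x /=.
by rewrite [LHS](AU C CU) /= [C (B x)](BU C CU).
Qed.

Lemma twist_bicommutant_iter n (A : H -> H) :
  twist_bicommutant A -> twist_bicommutant (iter n A).
Proof. by move=> AU C CU; apply: commuting_iter; exact: AU. Qed.

(** [A] commutes with each twist because the twists commute with one another, so [A] is itself a
    legitimate test map for [B]. *)
Lemma twist_bicommutant_commute (A B : H -> H) :
  twist_bicommutant A -> twist_bicommutant B -> commuting A B.
Proof.
move=> AU BU; apply: (BU A) => i j ij x.
by rewrite [RHS](AU (U i j)) // => p q pq; exact: twists_commute.
Qed.

(** [T] is the product of the [V j] along [s]. Moving [V i] past [V j] costs [U i j] if [i != j] and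
    nothing otherwise; [W] collects these factors. *)
Lemma twisted_product (s : seq 'I_k) : exists T : {linear H -> H},
  [/\ isometric T, forall i j, i != j -> commuting T (U i j),
      forall i, exists W W' : {linear H -> H},
        [/\ isometric W, twist_bicommutant W, twist_bicommutant W',
            cancel W W' /\ cancel W' W & forall x, V i (T x) = W (T (V i x))] &
      forall i, i \in s -> exists2 S : {linear H -> H},
        isometric S & forall x, T x = V i (S x)].
Proof.
elim: s => [|j s [T [Tiso TU TW TS]]].
  by exists idfun; split=> // i; exists idfun, idfun.
exists (V j \o T); split.
- by move=> x /=; rewrite (twisted_isometric VU).
- move=> p q pq x /=.
  by rewrite [T (U p q x)](TU _ _ pq) [LHS](twisted_twist VU j pq).
- move=> i; have [W [W' [Wiso WU W'U [WK W'K] VTW]]] := TW i.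
  have VjW x : V j (W x) = W (V j x).
    by apply: (WU (V j)) => p q; exact: (twisted_twist VU).
  have [<-|ij] := eqVneq i j.
    exists W, W'; split=> // x /=.
    by rewrite VTW; apply: (WU (V i)) => p q; exact: (twisted_twist VU).
  have ji : j != i by rewrite eq_sym.
  exists (U i j \o W), (W' \o U j i); split.
  + by move=> x /=; rewrite isometric_twist.
  + exact/twist_bicommutant_comp/WU/twist_bicommutant_twist.
  + exact/twist_bicommutant_comp/twist_bicommutant_twist.
  + by split=> x /=; [rewrite twistK// WK | rewrite W'K twistK].
  + by move=> x /=; rewrite [LHS](twisted_mul VU ij) /= VTW VjW.
- move=> i; rewrite inE; have [-> _|ij /= /TS[S Siso TE]] := eqVneq i j.
    by exists T.
  (* [V_j V_i S = U_ji V_i V_j S = V_i (U_ji V_j S)]. *)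
  exists (U j i \o (V j \o S)).
    by move=> x /=; rewrite isometric_twist 1?eq_sym// (twisted_isometric VU).
  move=> x /=; rewrite TE [RHS](twisted_twist VU); last by rewrite eq_sym.
  by rewrite /= [LHS](twisted_mul VU) // eq_sym.
Qed.

End TwistedTuples.

(** * Construction of the extension *)

Theorem theorem8p8 (R : realType) (H : hilbertType R) (k : nat)
    (V : 'I_k -> {linear H -> H}) (U : 'I_k -> 'I_k -> {linear H -> H}) :
  doubly_twisted V U ->
  exists (K : hilbertType R) (J : {linear H -> K})
    (hatV : 'I_k -> {linear K -> K})
    (hatU : 'I_k -> 'I_k -> {linear K -> K}),
    doubly_twisted_unitary_extension V U J hatV hatU.
Proof.
move=> VU.
have [T [Tiso TU TW TS]] := twisted_product VU (enum 'I_k).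
pose K : hilbertType R := orbit_space Tiso.
have [J [Jiso JE]] := orbit_embedding Tiso.
have VtU l i j : i != j -> commuting (V l) (U i j) by exact: (twisted_twist VU).
have /choice[FU FUP] (ij : 'I_k * 'I_k) : exists F : {linear K -> K},
    ij.1 != ij.2 -> exists G : {linear K -> K},
    [/\ forall h, `|F h| <= `|h|, forall h, `|G h| <= `|h|,
        cancel F G, cancel G F &
        forall (h : K) n y, inner y (F h n) = inner (U ij.2 ij.1 y) (h n)].
  (* Off the diagonal, [F] is termwise the adjoint of [U j i], that is [U i j]; on it, [idfun] is
     the default value that [choice] asks for. *)
  case: ij => i j /=; have [_|ij] := eqVneq i j; first by exists idfun.
  have ji : j != i by rewrite eq_sym.
  have [F [G FG]] := orbit_unitary Tiso (isometric_twist VU ij)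
    (isometric_twist VU ji) (twistK VU ij) (twistK VU ji) (TU _ _ ij) (TU _ _ ji).
  by exists F => _; exists G.
pose hatU i j := FU (i, j).
have hatUE i j h n y : i != j -> inner y (hatU i j h n) = inner (U j i y) (h n).
  by move=> ij; have [G []] := FUP (i, j) ij.
have hatUK i j : i != j -> cancel (hatU i j) (hatU j i).
  move=> ij h; apply: orbit_inner_eq => n y.
  by rewrite !hatUE ?(twistK VU)// eq_sym.
have hatU_le i j h : i != j -> `|hatU i j h| <= `|h|.
  by move=> ij; have [G []] := FUP (i, j) ij.
have hatU_unitary i j (ij : i != j) :
    [/\ isometric (hatU i j), adjoint (hatU i j) =1 hatU j i &
        unitary (hatU i j)].
  have ji : j != i by rewrite eq_sym.
  by apply: contraction_inverse_unitary => [h|h||]; auto.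
(* [F] extends [V i], [G] is its inverse, and [D n] is the twist correction [W_i^-n]. *)
have /choice[FV FVP] (i : 'I_k) : exists FGD :
    {linear K -> K} * {linear K -> K} * (nat -> {linear H -> H}),
    let: (F, G, D) := FGD in
    [/\ forall h, `|F h| <= `|h|, forall h, `|G h| <= `|h|,
        cancel F G /\ cancel G F,
        forall n, [/\ isometric (D n), twist_bicommutant (U := U) (D n) &
          forall x, iter n T (V i x) = D n (V i (iter n T x))] &
        forall (h : K) n y, inner y (G h n) = inner (D n (V i y)) (h n)].
  have [W [W' [Wiso WU W'U [WK W'K] VTW]]] := TW i.
  have [S Siso TE] := TS i (mem_enum _ i).
  have W'iso : isometric W' by move=> x; rewrite -[LHS]Wiso W'K.
  have [|||F [G [Fle Gle FK GK GE]]] := orbit_isometry Tiso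
    (twisted_isometric VU i) Siso Wiso W'iso WK W'K _ _ _ VTW TE.
  - by apply: WU => p q; exact: VtU.
  - exact: WU.
  - exact: W'U.
  exists (F, G, lpow W'); split=> //= n; split; first exact: isometric_lpow.
    2: by move=> x; apply: iter_twist VTW => //; exact: W'U.
  have -> : (lpow W' n : H -> H) = iter n W' by apply/funext; exact: lpowE.
  exact: twist_bicommutant_iter.
pose hatV i := (FV i).1.1; pose hatv i := (FV i).1.2; pose D i := (FV i).2.
have FVP' i : [/\ forall h, `|hatV i h| <= `|h|, forall h, `|hatv i h| <= `|h|,
    cancel (hatV i) (hatv i) /\ cancel (hatv i) (hatV i),
    forall n, [/\ isometric (D i n), twist_bicommutant (U := U) (D i n) &
      forall x, iter n T (V i x) = D i n (V i (iter n T x))] &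
    forall (h : K) n y, inner y (hatv i h n) = inner (D i n (V i y)) (h n)].
  by have := FVP i; rewrite /hatV /hatv /D; case: (FV i) => [[]].
have hatVK i : cancel (hatV i) (hatv i) by have [_ _ []] := FVP' i.
have hatvK i : cancel (hatv i) (hatV i) by have [_ _ []] := FVP' i.
have hatvE i h n y : inner y (hatv i h n) = inner (D i n (V i y)) (h n).
  by have [_ _ _ _] := FVP' i; exact.
have Diso i n : isometric (D i n) by have [_ _ _ /(_ n)[]] := FVP' i.
have DU i n : twist_bicommutant (U := U) (D i n).
  by have [_ _ _ /(_ n)[]] := FVP' i.
have DT i n x : iter n T (V i x) = D i n (V i (iter n T x)).
  by have [_ _ _ /(_ n)[]] := FVP' i.
have hatV_unitary i :
    [/\ isometric (hatV i), adjoint (hatV i) =1 hatv i & unitary (hatV i)].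
  by have [Fle Gle _ _ _] := FVP' i; exact: contraction_inverse_unitary.
have DV i n l x : V l (D i n x) = D i n (V l x).
  by apply: (DU i n (V l)) => p q; exact: VtU.
have DD i m j n x : D i m (D j n x) = D j n (D i m x).
  exact: (twist_bicommutant_commute VU (DU i m) (DU j n)).
have UD i j l n (ij : i != j) x : U i j (D l n x) = D l n (U i j x).
  by apply: (DU l n (U i j)) => p q pq; exact: (twists_commute VU).
have hatvU l i j (ij : i != j) h : hatv l (hatU i j h) = hatU i j (hatv l h).
  have ji : j != i by rewrite eq_sym.
  apply: orbit_inner_eq => n y; rewrite hatvE !hatUE// hatvE UD//.
  by rewrite -[U j i (V l y)](VtU l _ _ ji).
have hatVU l i j (ij : i != j) h : hatV l (hatU i j h) = hatU i j (hatV l h).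
  by apply: (can_inj (hatvK l)); rewrite hatVK hatvU// hatVK.
have hatVV i j (ij : i != j) h :
    hatV i (hatV j h) = hatU i j (hatV j (hatV i h)).
  have ji : j != i by rewrite eq_sym.
  (* For [g = hatV j (hatV i h)] the claim is [hatv i (hatv j g) = hatv j (hatv i (hatU i j g))]. In
     each term the factors [D] come out, leaving [V_j V_i = U_ji V_i V_j]. *)
  apply: (can_inj (hatvK i)); apply: (can_inj (hatvK j)); rewrite !hatVK.
  rewrite -[LHS](hatVK i) -[in LHS](hatVK j (hatV i h)).
  set g := hatV j (hatV i h).
  apply: orbit_inner_eq => n y; rewrite !hatvE hatUE//.
  rewrite !DV DD UD// UD//; congr (inner (D _ _ (D _ _ _)) _).
  by rewrite [RHS](esym (twisted_mul VU ji y)).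
exists K, J, hatV, hatU; split.
- exact: Jiso.
- by move=> i; have [] := hatV_unitary i.
- by move=> i j /hatU_unitary[].
(* After applying [hatv i], the isometry [D_n V_i] stands on both sides of the inner product, as
   [T^n V_i = D_n V_i T^n]. *)
- move=> i x; apply: (can_inj (hatvK i)); rewrite hatVK.
  apply: orbit_inner_eq => n y; rewrite hatvE !JE DT isometric_inner//.
  by rewrite isometric_inner//; exact: (twisted_isometric VU).
- move=> i j ij x; have ji : j != i by rewrite eq_sym.
  apply: orbit_inner_eq => n y; rewrite hatUE// !JE.
  have UTn := commuting_iter n (fun z => esym (TU i j ij z)).
  rewrite -[iter n T (U i j x)]UTn.
  by rewrite -[LHS](isometric_inner (isometric_twist VU ij)) (twistK VU).
split.
- by move=> i; have [] := hatV_unitary i.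
- by move=> i j ij; have [] := hatU_unitary i j (negbT (ltn_eqF ij)).
- move=> i j p q ij pq h /=.
  have [ij' pq'] := (negbT (ltn_eqF ij), negbT (ltn_eqF pq)).
  apply: orbit_inner_eq => n y; rewrite !hatUE//; congr (inner _ _).
  by apply: (twists_commute VU); rewrite eq_sym.
- move=> i j ij h; have [_ -> //] := hatU_unitary i j (negbT (ltn_eqF ij)).
- by move=> i j ij h; exact: hatVV.
- move=> i j ij h /=; have [_ -> _] := hatU_unitary i j ij.
  have [_ vE _] := hatV_unitary i; rewrite !vE.
  (* With adjoints now inverses, substituting [h = hatV i g] and applying [hatV i] turns the
     relation into [hatVV] for the pair [j], [i]. *)
  rewrite -{1}(hatvK i h); set g := hatv i h.
  apply: (can_inj (hatVK i)); rewrite hatvK hatVU 1?eq_sym//.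
  by apply: hatVV; rewrite eq_sym.
- by move=> i j l ij h; exact: hatVU.
Qed.
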